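(* There does not exist any finite constant $c$ such that the inequality $$l_v(g)\,l_\sigma(g)\,l_h(g)\le c\cdot \mathrm{vol}(g)^{\frac32}$$ holds for every Riemannian metric $g$ on the Klein bottle $K$.
   Context: The Klein bottle $K$ is the quotient of $\mathbb{R}^2=\mathbb{C}$ by the group generated by $\sigma: z\mapsto \bar z+\pi$ and $t: z\mapsto z+2i\beta$, where $\beta>0$; this group is identified with $\pi_1(K)$, and $g_\beta$ denotes the induced flat metric. Every Riemannian metric on $K$ is conformally equivalent to $g_\beta$ for some $\beta>0$. $\mathrm{vol}(g)$ is the total area. Lengths, measured with respect to $g$: - $l_\sigma(g)$: least length of a closed curve in the free homotopy class of the glide reflection $\sigma$; - $l_v(g)$: least length of a closed curve in the free homotopy class of the vertical translation $t$; - $l_h(g)$: least length of a closed curve in the free homotopy class of the horizontal translation $\sigma^2$. *)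

(* Defs.v *)
From HB Require Import structures.
From mathcomp Require Import all_boot all_order all_algebra.
From mathcomp Require Import generic_quotient.
From mathcomp Require Import all_classical all_reals all_analysis.

Set Implicit Arguments.
Unset Strict Implicit.
Unset Printing Implicit Defensive.

Import Order.TTheory GRing.Theory Num.Theory.
Import numFieldNormedType.Exports.

Local Open Scope classical_set_scope.
Local Open Scope ring_scope.
Local Open Scope quotient_scope.

Section KleinBottle.
Context {R : realType}.

(* The point x + i y of the complex plane is the pair (x, y). *)
Local Notation plane := (R * R)%type.

Definition glide (z : plane) : plane := (z.1 + pi, - z.2).

Definition vtrans (beta : R) (z : plane) : plane := (z.1, z.2 + 2 * beta).

(* The group of transformations of the plane generated by glide and vtrans. *)
Inductive deck (beta : R) : (plane -> plane) -> Prop :=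
| deck_id : deck beta id
| deck_glide : deck beta glide
| deck_vtrans : deck beta (vtrans beta)
| deck_comp f g : deck beta f -> deck beta g -> deck beta (f \o g)
| deck_inv f g : deck beta f -> cancel f g -> cancel g f -> deck beta g.

Definition same_orbit (beta : R) : rel plane :=
  fun z w => `[< exists2 f, deck beta f & f z = w >].

Lemma deck_has_inv (beta : R) f :
  deck beta f -> exists g, [/\ deck beta g, cancel f g & cancel g f].
Proof.
elim=> {f} [||| f g _ [f' [df' fK f'K]] _ [g' [dg' gK g'K]] | f g df _ fK gK].
- by exists id; split=> //; exact: deck_id.
- pose h (z : plane) : plane := (z.1 - pi, - z.2).
  have hK : cancel glide h by case=> x y; rewrite /h /glide /= addrK opprK.
  have Kh : cancel h glide by case=> x y; rewrite /h /glide /= subrK opprK.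
  by exists h; split=> //; exact: deck_inv (deck_glide beta) hK Kh.
- pose h (z : plane) : plane := (z.1, z.2 - 2 * beta).
  have hK : cancel (vtrans beta) h by case=> x y; rewrite /h /vtrans /= addrK.
  have Kh : cancel h (vtrans beta) by case=> x y; rewrite /h /vtrans /= subrK.
  by exists h; split=> //; exact: deck_inv (deck_vtrans beta) hK Kh.
- exists (g' \o f'); split; first exact: deck_comp.
  + exact: can_comp.
  + exact: can_comp.
- by exists f; split.
Qed.

Lemma same_orbit_equiv (beta : R) : equiv_class_of (same_orbit beta).
Proof.
split.
- by move=> z; apply/asboolP; exists id => //; exact: deck_id.
- have sym z w : same_orbit beta z w -> same_orbit beta w z.
    move=> /asboolP[f /deck_has_inv[g [dg fK _]] <-].
    by apply/asboolP; exists g.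
  by move=> z w; apply/idP/idP; exact: sym.
- move=> w z u /asboolP[f df <-] /asboolP[g dg <-].
  by apply/asboolP; exists (g \o f) => //; exact: deck_comp.
Qed.

Canonical same_orbit_equiv_rel (beta : R) := EquivRelPack (same_orbit_equiv beta).

Definition klein (beta : R) :=
  quotient_topology {eq_quot same_orbit_equiv_rel beta}.

Definition klein_proj (beta : R) : plane -> klein beta := \pi_(klein beta).

(* C^infinity: every iterated directional derivative is differentiable. *)
Definition smooth (f : plane -> R) : Prop :=
  forall (vs : seq plane) (z : plane),
    differentiable (foldr (fun v h => 'D_v h) f vs) z.

(* Since klein_proj is a covering whose deck group acts by diffeomorphisms,
   a Riemannian metric on the Klein bottle is the same thing as a Riemannian
   metric on the plane for which the deck transformations are isometries. *)
Record klein_metric (beta : R) := KleinMetric {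
  klein_form :> plane -> plane -> plane -> R;
  klein_linear : forall (z u v w : plane) (a : R),
    klein_form z (a *: u + v) w = a * klein_form z u w + klein_form z v w;
  klein_sym : forall z v w : plane, klein_form z v w = klein_form z w v;
  klein_pos : forall z v : plane, v != 0 -> 0 < klein_form z v v;
  klein_smooth : forall v w : plane, smooth (fun z => klein_form z v w);
  klein_invariant : forall f, deck beta f -> forall z v w : plane,
    klein_form (f z) ('d f z v) ('d f z w) = klein_form z v w
}.

(* The rectangle [0, pi] x [0, 2 beta] is a fundamental domain. *)
Definition vol (beta : R) (g : klein_metric beta) : R :=
  \int[(@lebesgue_measure R \x @lebesgue_measure R)%E]_(z in
      `[0, pi] `*` `[0, 2 * beta])
    Num.sqrt (g z (1, 0) (1, 0) * g z (0, 1) (0, 1) - g z (1, 0) (0, 1) ^+ 2).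

Definition C1_curve (d : R -> plane) : Prop :=
  (forall t, derivable d t 1) /\ continuous (derive1 d).

Definition piecewise_C1 (c : R -> plane) : Prop :=
  exists2 s : seq R, itv_partition 0 1 s &
    forall i, (i < size s)%N ->
      exists2 d : R -> plane, C1_curve d &
        {in `[nth 0 (0 :: s) i, nth 0 (0 :: s) i.+1], c =1 d}.

Definition curve_length (beta : R) (g : klein_metric beta) (c : R -> plane) : R :=
  \int[@lebesgue_measure R]_(t in `[0, 1]) Num.sqrt (g (c t) (derive1 c t) (derive1 c t)).

(* Loops are parametrized by [0, 1]; their values elsewhere are irrelevant. *)
Definition freely_homotopic (T : topologicalType) (a b : R -> T) : Prop :=
  exists H : R * R -> T,
    [/\ {within `[0, 1] `*` `[0, 1], continuous H},
        {in `[0, 1], forall t, H (0, t) = a t},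
        {in `[0, 1], forall t, H (1, t) = b t} &
        {in `[0, 1], forall s, H (s, 0) = H (s, 1)}].

(* The loop of the Klein bottle which corresponds to the deck transformation f
   under the identification of the deck group with the fundamental group: the
   projection of the segment from the origin to its image by f. *)
Definition deck_loop (beta : R) (f : plane -> plane) (t : R) : klein beta :=
  klein_proj beta (t *: f 0).

(* A piecewise C^1 closed curve of the Klein bottle is given by a lift c to the
   plane; the least length is the infimum over such curves. *)
Definition least_length (beta : R) (g : klein_metric beta)
    (f : plane -> plane) : R :=
  inf [set L | exists c : R -> plane,
    [/\ piecewise_C1 c,
        klein_proj beta (c 0) = klein_proj beta (c 1),
        freely_homotopic (klein_proj beta \o c) (deck_loop beta f) &
        L = curve_length g c]].

Definition l_sigma (beta : R) (g : klein_metric beta) : R :=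
  least_length g glide.

Definition l_v (beta : R) (g : klein_metric beta) : R :=
  least_length g (vtrans beta).

Definition l_h (beta : R) (g : klein_metric beta) : R :=
  least_length g (glide \o glide).

End KleinBottle.

(* Main.v *)
Require Import Defs.
From HB Require Import structures.
From mathcomp Require Import all_boot all_order all_algebra.
From mathcomp Require Import generic_quotient.
From mathcomp Require Import all_classical all_reals all_analysis.
From mathcomp Require Import measurable_realfun.
From mathcomp Require Import zify ring lra.

Import Order.TTheory GRing.Theory Num.Theory.
Import numFieldNormedType.Exports.

Local Open Scope ring_scope.

(** The flat metrics [a^2 dx^2 + a^-2 dy^2] already violate every such
    inequality: they all have area [2 beta pi], whereas a curve in the class of
    the deck transformation [f] has a lift whose ends differ by a conjugate of
    [f], so that [l_sigma >= a pi], [l_h >= 2 a pi] and [l_v >= 2 beta / a], and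
    the product of the three lengths grows linearly in [a].

    Free homotopies are lifted to the plane on a fine grid only. Two points of
    the same orbit at distance less than [min pi (2 beta)] coincide, so a chain
    of sufficiently close points of the Klein bottle has a unique lift with
    prescribed origin, and the lifts of two neighbouring rows of the grid stay
    close to each other, hence end with the same deck transformation. *)

(** * Uniform continuity on compact sets *)

Section Uniformity.
Local Open Scope classical_set_scope.
Context {R : realType}.

(** Lebesgue number argument. Closeness in the target is an arbitrary relation [N], because the
    Klein bottle only carries its quotient topology. *)
Lemma compact_uniform_near (T : pseudoMetricType R)
    (X : topologicalType) (A : set T) (F : T -> X) (N : X -> X -> Prop) :
  compact A -> {within A, continuous F} ->
  (forall z, A z ->
     exists2 U, nbhs (F z) U & forall x y, U x -> U y -> N x y) ->
  \forall d \near (0 : R)^'+,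
    forall x y, A x -> A y -> ball x d y -> N (F x) (F y).
Proof.
move=> /compact_near_coveringP cA /subspace_continuousP cF locN.
pose P (d : R) (x : T) := A x -> forall y, A y -> ball x d y -> N (F x) (F y).
have /cA : forall x, A x ->
    filter_prod (nbhs x) (0 : R)^'+ (fun xd : T * R => P xd.2 xd.1).
  move=> x Ax; have [U FU UN] := locN _ Ax.
  have := cF _ Ax _ FU; rewrite /= nbhs_simpl /within /= => /nbhs_ballP[e /= e0 eU].
  have e20 : 0 < e / 2 by rewrite divr_gt0.
  (* Half the radius: if [x'] is near [x] and [y] is near [x'], both lie in [ball x e]. *)
  exists (ball x (e / 2), [set d | d < e / 2]).
    by split; [exact: nbhsx_ballx|exact: nbhs_right_lt].
  move=> [x' d] [/= xx' de] Ax' y Ay x'y; apply: UN; apply: eU => //.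
    by apply: le_ball xx'; lra.
  by apply: ball_split xx' _; apply: le_ball x'y; exact: ltW.
by apply: filterS => d + x y Ax Ay; apply.
Qed.

Lemma right_near_natSinv (P : R -> Prop) :
  (\forall d \near (0 : R)^'+, P d) -> exists2 d, P d & exists n, n.+1%:R^-1 < d.
Proof.
move=> nP; near (0 : R)^'+ => d.
have d0 : 0 < d by [].
exists d; first by near: d.
near \oo%classic => n; exists n.
by near: n; exact: (near_infty_natSinv_lt (PosNum d0)).
Unshelve. all: by end_near. Qed.

End Uniformity.

(** * The deck group and the covering of the Klein bottle by the plane *)

Section Lifting.
Local Open Scope classical_set_scope.
Context {R : realType}.
Variable beta : R.
Hypothesis beta_gt0 : 0 < beta.
Local Notation plane := (R * R)%type.

(** The element t^k sigma^m, with sigma the glide and t the vertical translation. *)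
Definition deck_normal (m k : int) (z : plane) : plane :=
  (z.1 + m%:~R * pi, ((-1) ^ m : int)%:~R * z.2 + k%:~R * (2 * beta)).

Lemma sign_sqr (m : int) : (-1) ^ m * (-1) ^ m = 1 :> int.
Proof. by rewrite -exprzMl ?unitrN1// mulrNN mulr1 exp1rz. Qed.

Lemma norm_sign (m : int) : `|((-1) ^ m : int)%:~R| = 1 :> R.
Proof.
have /eqP := congr1 (fun i : int => i%:~R : R) (sign_sqr m).
by rewrite intrM -expr2 sqrf_eq1 => /orP[] /eqP ->; rewrite ?normrN normr1.
Qed.

(** Since sigma t sigma^-1 = t^-1, the elements t^k sigma^m are closed under composition and
    inversion; moving sigma^m across a power of t produces the sign [(-1) ^ m]. *)
Lemma deck_normalP f : deck beta f -> exists m k, f =1 deck_normal m k.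
Proof.
elim=> {f} [||| f g _ [m [k fE]] _ [m' [k' gE]] | f g _ [m [k fE]] fK gK].
- by exists 0, 0 => -[x y]; rewrite /deck_normal expr0z !mul0r !addr0 mul1r.
- exists 1, 0 => -[x y].
  by rewrite /deck_normal /glide expr1z mul0r addr0 mul1r mulN1r.
- exists 0, 1 => -[x y].
  by rewrite /deck_normal /vtrans expr0z mul0r addr0 !mul1r.
- exists (m + m'), (k + (-1) ^ m * k') => z.
  rewrite /= gE fE /deck_normal /= exprzDr ?unitrN1// !(intrD, intrM).
  by congr pair; ring.
- exists (- m), (- ((-1) ^ m * k)) => z.
  apply: (can_inj fK); rewrite gK fE /deck_normal /=.
  have := sign_sqr m; rewrite -exprz_inv invrN1 => /(congr1 (fun i : int => i%:~R : R)).
  rewrite !(intrM, intrN) => s2.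
  case: z => x y /=; congr pair; first by ring.
  set s := (_ ^ m)%:~R in s2 *; ring: s2.
Qed.

Lemma deck_isometry f z w e : deck beta f -> ball z e w -> ball (f z) e (f w).
Proof.
move=> /deck_normalP[m [k fE]] [/= z1 z2]; rewrite !fE; split => /=.
- by move: z1; rewrite /ball /= opprD addrACA subrr addr0.
- move: z2; rewrite /ball /= opprD addrACA subrr addr0 -mulrBr normrM.
  by rewrite norm_sign mul1r.
Qed.

(** A horizontal shift [m pi] smaller than [pi] forces [m = 0]. The reflection then disappears, and
    a vertical shift smaller than [2 * beta] forces [k = 0]. *)
Lemma deck_small_id f z : deck beta f -> ball z (Num.min pi (2 * beta)) (f z) ->
  f z = z.
Proof.
move=> /deck_normalP[m [k fE]].
have int_small (i : int) (r : R) : 0 < r -> `|i%:~R * r| < r -> i = 0.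
  move=> r0; rewrite normrM (gtr0_norm r0) gtr_pMl// -intr_norm.
  by rewrite ltrz1; lia.
rewrite fE => -[/=]; rewrite /ball /= /deck_normal !lt_min => /andP[m1 _] /andP[_].
have m0 : m = 0.
  by apply: (int_small _ _ (pi_gt0 R)); rewrite opprD addNKr normrN in m1.
rewrite m0 expr0z mul1r opprD addNKr normrN.
have b0 : 0 < 2 * beta by rewrite mulr_gt0.
move=> /(int_small _ _ b0) ->.
by rewrite !mul0r !addr0; case: (z).
Qed.

Lemma klein_proj_eq z w :
  klein_proj beta z = klein_proj beta w <-> exists2 f, deck beta f & f z = w.
Proof.
split.
- by move/eqmodP/asboolP.
- by move=> ?; apply/eqmodP/asboolP.
Qed.

(** Closeness in the quotient is read on some pair of lifts; as deck transformations are isometries,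
    one of the two lifts may be prescribed. *)
Definition klein_near (e : R) (x y : klein beta) : Prop :=
  exists z w, [/\ klein_proj beta z = x, klein_proj beta w = y & ball z e w].

Lemma klein_near_lift e z y : klein_near e (klein_proj beta z) y ->
  exists2 w, klein_proj beta w = y & ball z e w.
Proof.
move=> [z' [w [/klein_proj_eq[f df <-] <- zw]]].
exists (f w); last exact: deck_isometry.
by apply/esym/klein_proj_eq; exists f.
Qed.

Lemma klein_proj_inj z w : klein_proj beta z = klein_proj beta w ->
  ball z (Num.min pi (2 * beta)) w -> z = w.
Proof.
by move=> /klein_proj_eq[f df <-] zw; apply/esym/deck_small_id.
Qed.

(** The projection is open: the saturation of a ball is the union of its translates, and near a
    point of one translate the inverse deck transformation, an isometry, brings points back into the
    ball. *)
Lemma klein_proj_nbhs (z : plane) (e : R) : 0 < e ->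
  nbhs (klein_proj beta z) (klein_proj beta @` ball z e).
Proof.
move=> e0; apply: open_nbhs_nbhs; split; last by exists z => //; exact: ballxx.
rewrite /open /= /quotient_open openE => w [u zu /klein_proj_eq[f df fu]].
have [g [dg fK gK]] := deck_has_inv df.
have : nbhs u (ball z e) by apply: open_nbhs_nbhs; split=> //; exact: ball_open.
move=> /nbhs_ballP[r /= r0 ur]; apply/nbhs_ballP; exists r => //= w' ww'.
exists (g w').
- by apply: ur; rewrite -(fK u) fu; exact: deck_isometry.
- by apply/klein_proj_eq; exists f => //.
Qed.

(** * Discrete lifting of paths and homotopies *)

Local Notation proj := (klein_proj beta).
Let rho := Num.min pi (2 * beta).
Let eps := rho / 4.

Let rho_gt0 : 0 < rho.
Proof. by rewrite lt_min pi_gt0 mulr_gt0. Qed.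

Let eps_gt0 : 0 < eps.
Proof. by rewrite divr_gt0. Qed.

Definition chain_lift (n : nat) (u : nat -> klein beta) (z : nat -> plane) :=
  (forall j, (j <= n)%N -> proj (z j) = u j) /\
  (forall j, (j < n)%N -> ball (z j) eps (z j.+1)).

Lemma chain_lift_exists n u z0 :
  (forall j, (j < n)%N -> klein_near eps (u j) (u j.+1)) -> proj z0 = u 0 ->
  exists2 z, z 0 = z0 & chain_lift n u z.
Proof.
elim: n => [_ p0|n IH un p0]; first by exists (fun=> z0) => //; split => // -[].
have [|z z00 [zu zz]] := IH _ p0; first by move=> j jn; apply: un; exact: ltnW.
have := un n (leqnn _); rewrite -(zu n)// => /klein_near_lift[w pw zw].
exists (fun j => if (j <= n)%N then z j else w); first by [].
split=> j; rewrite leq_eqVlt => /predU1P[].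
- by move=> ->; rewrite ltnn.
- by rewrite ltnS => jn; rewrite jn zu.
- by move=> [->]; rewrite leqnn ltnn.
- by rewrite ltnS => jn; rewrite jn (ltnW jn); exact: zz.
Qed.

(* A lift is determined by its projection up to distance [rho = 4 eps], which
   leaves room for one step of each lift, one of [u] to [v] and the gap. *)
Lemma chain_lift_parallel n u v z w :
  (forall j, (j <= n)%N -> klein_near eps (u j) (v j)) ->
  chain_lift n u z -> chain_lift n v w -> ball (z 0) eps (w 0) ->
  forall j, (j <= n)%N -> ball (z j) eps (w j).
Proof.
move=> uv [zu zz] [wv ww] zw0; elim=> [//|j IH jn].
have := uv j.+1 jn; rewrite -(zu j.+1 jn) => /klein_near_lift[w' w'v zw'].
suff -> : w j.+1 = w' by [].
apply: klein_proj_inj; first by rewrite w'v wv.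
have -> : Num.min pi (2 * beta) = eps + eps + (eps + eps).
  by rewrite -/rho /eps; field.
apply: (@ball_triangle _ _ (z j)).
  apply: (@ball_triangle _ _ (w j)); apply: ball_sym; first exact: ww.
  exact: IH (ltnW jn).
by apply: (@ball_triangle _ _ (z j.+1)); first exact: zz.
Qed.

(** Compare [u] with itself: the two lifts stay within [eps < rho] of each other and have the same
    projection. *)
Lemma chain_lift_unique n u z w : chain_lift n u z -> chain_lift n u w ->
  z 0 = w 0 -> forall j, (j <= n)%N -> z j = w j.
Proof.
move=> zu wu zw0 j jn; apply: klein_proj_inj.
  by rewrite zu.1// wu.1.
have : ball (z j) eps (w j).
  apply: (chain_lift_parallel n u u) => //; last by rewrite zw0; exact: ballxx.
  move=> i lein; exists (z i), (z i); rewrite zu.1//; split=> //.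
  exact: ballxx.
by apply: le_ball; have := rho_gt0; rewrite /eps /rho; lra.
Qed.

(** Induction on the rows. The end [w' n] of the next lift and [g (w' 0)] have the same projection,
    and both are within [eps] of [w n = g (w 0)]; being less than [rho] apart, they coincide. *)
Lemma chain_lift_monodromy n (U : nat -> nat -> klein beta) g z :
  deck beta g ->
  (forall i j, (i <= n)%N -> (j < n)%N -> klein_near eps (U i j) (U i j.+1)) ->
  (forall i j, (i < n)%N -> (j <= n)%N -> klein_near eps (U i j) (U i.+1 j)) ->
  (forall i, (i <= n)%N -> U i 0 = U i n) ->
  chain_lift n (U 0) z -> z n = g (z 0) ->
  forall i, (i <= n)%N -> exists2 w, chain_lift n (U i) w & w n = g (w 0).
Proof.
move=> dg Uh Uv Uper zU zg; elim=> [_|i IH lein]; first by exists z.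
have [w wU wg] := IH (ltnW lein).
have := Uv i 0 lein isT; rewrite -wU.1// => /klein_near_lift[w0 pw0 ww0].
have [w' w'0 w'U] := chain_lift_exists n (U i.+1) w0
  (fun j => Uh i.+1 j lein) pw0.
exists w' => //.
have near_end : ball (w n) eps (w' n).
  apply: (chain_lift_parallel n (U i) (U i.+1)) => //; first by move=> j; exact: Uv.
  by rewrite w'0.
apply: klein_proj_inj.
  rewrite w'U.1// -Uper// -w'U.1//; apply/klein_proj_eq; by exists g.
have : ball (w' n) (eps + eps) (g (w' 0)).
  apply: (@ball_triangle _ _ (w n)); first exact: ball_sym.
  by rewrite wg; apply: deck_isometry => //; rewrite w'0.
apply: le_ball; rewrite -/rho.
by have := rho_gt0; rewrite /eps; lra.
Qed.

(** The transformation [g] relating the ends of [c] persists along all rows of the grid. The last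
    row is the projection of the segment from [0] to [f 0], so its lift is the translate of that
    segment by some [h]; comparing ends shows that [g] agrees with the conjugate h f h^-1 at
    [h 0]. *)
Lemma free_homotopy_conjugate f (c : R -> plane) : deck beta f ->
  {within `[0, 1], continuous c} -> proj (c 0) = proj (c 1) ->
  freely_homotopic (proj \o c) (deck_loop beta f) ->
  exists g h, [/\ deck beta g, deck beta h, g (h 0) = h (f 0) & c 1 = g (c 0)].
Proof.
move=> df cc /klein_proj_eq[g dg gc] [H [cH H0 H1 Hper]].
have I01 : compact (`[0, 1] : set R) by exact: segment_compact.
have unifH := compact_uniform_near _ _ _ H (klein_near eps)
  (compact_setX I01 I01) cH.
have unif_plane (d : R -> plane) :=
  compact_uniform_near _ _ _ d (fun z w => ball z eps w) I01.
have ball_half (z : plane) : exists2 U : set plane, nbhs z U &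
    forall x y, U x -> U y -> ball x eps y.
  exists (ball z (eps / 2)); first by apply: nbhsx_ballx; rewrite divr_gt0.
  move=> x y zx zy; apply: (@ball_split _ _ z) => //.
  exact: ball_sym.
have {}unifH := unifH _; have unifc := unif_plane c cc (fun t _ => ball_half (c t)).
have unifl := unif_plane (fun t => t *: f 0) _ (fun t _ => ball_half _).
(* A single mesh serves the homotopy, the curve and the segment. *)
have [d [[dH dc] dl] [n nd]] : exists2 d : R,
  ((forall x y : R * R, (`[0, 1] `*` `[0, 1]) x -> (`[0, 1] `*` `[0, 1]) y ->
     ball x d y -> klein_near eps (H x) (H y)) /\
   (forall x y : R, x \in `[0, 1]%R -> y \in `[0, 1]%R ->
     ball x d y -> ball (c x) eps (c y))) /\
   (forall x y : R, x \in `[0, 1]%R -> y \in `[0, 1]%R ->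
     ball x d y -> ball (x *: f 0) eps (y *: f 0))
  & exists n, n.+1%:R^-1 < d.
  apply: right_near_natSinv; near=> d; split; first split; near: d.
  (* Two points in the image of a ball of radius [eps / 2] have lifts less than [eps] apart. *)
  - apply: unifH => z _; exists (proj @` ball (repr (H z)) (eps / 2)).
      rewrite -{1}(reprK (H z)); apply: klein_proj_nbhs; by rewrite divr_gt0.
    move=> _ _ [x zx <-] [y zy <-]; exists x, y; split=> //.
    apply: (@ball_split _ _ (repr (H z))) => //; exact: ball_sym.
  - exact: unifc.
  - apply: unifl; apply: continuous_subspaceT => t.
    exact: scalel_continuous.
pose N := n.+1; pose t (i : nat) : R := i%:R / N%:R.
have N0 : 0 < N%:R :> R by [].
have t0 : t 0 = 0 by rewrite /t mul0r.
have tN : t N = 1 by rewrite /t divff// gt_eqF.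
have tI i : (i <= N)%N -> t i \in `[0, 1]%R.
  move=> iN; rewrite in_itv /= divr_ge0//=.
  by rewrite ler_pdivrMr// mul1r ler_nat.
have tS i : ball (t i) d (t i.+1).
  rewrite /ball /= /t -mulrBl -natr1 opprD addNKr normrM normrN1 mul1r.
  by rewrite gtr0_norm ?invr_gt0.
have d0 : 0 < d by apply: le_lt_trans nd; rewrite invr_ge0.
(* The first row of the grid is sampled from the projection of [c], so [c] itself lifts it. *)
have cU : chain_lift N (fun j => H (t 0, t j)) (c \o t).
  split=> [j jN|j jN]; first by rewrite t0 H0// tI.
  by apply: dc => //; apply: tI => //; exact: ltnW.
pose U i j : klein beta := H (t i, t j).
have Uh i j : (i <= N)%N -> (j < N)%N -> klein_near eps (U i j) (U i j.+1).
  move=> iN jN; apply: dH; last by split=> //=; exact: ballxx.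
    by split; apply: tI => //; exact: ltnW.
  by split; apply: tI.
have Uv i j : (i < N)%N -> (j <= N)%N -> klein_near eps (U i j) (U i.+1 j).
  move=> iN jN; apply: dH; last by split=> //=; exact: ballxx.
    by split; apply: tI => //; exact: ltnW.
  by split; apply: tI.
have Uper i : (i <= N)%N -> U i 0 = U i N.
  by move=> iN; rewrite /U t0 tN Hper// tI.
have cg : (c \o t) N = g ((c \o t) 0) by rewrite /= tN t0.
have [w wU wg] := chain_lift_monodromy N U g _ dg Uh Uv Uper cU cg N (leqnn _).
have : proj 0 = proj (w 0).
  by rewrite wU.1// /U tN t0 H1 ?in_itv/= ?lexx ?ler01// /deck_loop scale0r.
move=> /klein_proj_eq[h dh hw].
have lU : chain_lift N (fun j => H (t N, t j)) (fun j => h (t j *: f 0)).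
  split=> j jN.
    rewrite /U tN H1 ?tI// /deck_loop; apply/esym/klein_proj_eq; by exists h.
  apply: deck_isometry => //; apply: dl => //; apply: tI => //; exact: ltnW.
have lw := chain_lift_unique N _ _ _ lU wU.
exists g, h; split=> //.
have := lw _ N (leqnn _); rewrite wg tN scale1r t0 scale0r hw => ->//.
Unshelve. all: by end_near. Qed.

End Lifting.

(** * Lower bounds for the length of piecewise C^1 curves *)

Section Length.
Local Open Scope classical_set_scope.
Context {R : realType}.
Local Notation plane := (R * R)%type.
Local Notation mu := (@lebesgue_measure R).

Lemma derivable_linear_comp (phi : {linear plane -> R^o}) (d : R -> plane) t :
  continuous phi -> derivable d t 1 ->
  derivable (phi \o d : R -> R) t 1 /\ derive1 (phi \o d : R -> R) t = phi (derive1 d t).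
Proof.
move=> cphi /derivable1_diffP dd.
have dphi : differentiable (phi : plane -> R^o) (d t) by exact: linear_differentiable.
have dc : differentiable (phi \o d : R -> R^o) t by exact: differentiable_comp.
split; first exact/derivable1_diffP.
by rewrite !derive1E !deriveE// diff_comp// diff_lin.
Qed.

(** End points are negligible. A piece of a curve agrees with a C^1 curve on a closed interval only,
    which determines its derivative just on the open one. *)
Lemma integrable_eq_itvoo (f g : R -> R) p q : {in `]p, q[%R, f =1 g} ->
  mu.-integrable `[p, q] (EFin \o g) ->
  mu.-integrable `[p, q] (EFin \o f) /\
  \int[mu]_(t in `[p, q]) f t = \int[mu]_(t in `[p, q]) g t.
Proof.
move=> fg ig.
have mg : measurable_fun `]p, q[ g.
  apply: (@measurable_funS _ _ _ _ `[p, q]) => //; first exact: subset_itv_oo_cc.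
  by apply/measurable_EFinP; exact: measurable_int ig.
have mf : measurable_fun `]p, q[ f.
  by apply: eq_measurable_fun mg => t; rewrite inE /= => /fg.
have intE : (\int[mu]_(t in `[p, q]) (f t)%:E = \int[mu]_(t in `[p, q]) (g t)%:E)%E.
  exact: (eq_integral_itv_bounded true false mf mg).
have absE : (\int[mu]_(t in `[p, q]) (`|f t|)%:E =
    \int[mu]_(t in `[p, q]) (`|g t|)%:E)%E.
  apply: (eq_integral_itv_bounded true false).
  - exact: measurableT_comp mf.
  - exact: measurableT_comp mg.
  - by move=> t /fg ->.
split; last by rewrite /Rintegral intE.
apply/integrableP; split.
  apply/measurable_EFinP/measurable_fun_itv_obnd_cbndP.
  exact/measurable_fun_itv_bndo_bndcP.
by have /integrableP[_] := ig; rewrite /= absE.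
Qed.

(** Integrability is carried along because the real-valued integral is [0] by default when the
    extended one is infinite, and additivity could then fail. *)
Lemma Rintegral_itv_cat (f : R -> R) p x q : p <= x -> x <= q ->
  mu.-integrable `[p, x] (EFin \o f) -> mu.-integrable `[x, q] (EFin \o f) ->
  mu.-integrable `[p, q] (EFin \o f) /\
  \int[mu]_(t in `[p, q]) f t =
    \int[mu]_(t in `[p, x]) f t + \int[mu]_(t in `[x, q]) f t.
Proof.
move=> px xq i1 i2.
have i2' : mu.-integrable `]x, q] (EFin \o f).
  by apply: integrableS i2 => //; exact: subset_itv_oc_cc.
have pqU : `[p, q] = `[p, x] `|` `]x, q].
  by rewrite (@itv_bndbnd_setU _ _ _ (BRight x)).
have mf : measurable_fun `[p, q] (EFin \o f).
  rewrite pqU; apply/measurable_funU => //.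
  by split; [exact: measurable_int i1|exact: measurable_int i2'].
have i12 : mu.-integrable `[p, q] (EFin \o f).
  apply/integrableP; split=> //.
  rewrite pqU ge0_integral_setU //=.
  - apply: lte_add_pinfty; first by have /integrableP[] := i1.
    by have /integrableP[] := i2'.
  - rewrite -pqU; apply/measurable_EFinP/measurableT_comp => //.
    exact/measurable_EFinP.
  - apply/disj_set2P; rewrite -subset0 => t [] /=.
    rewrite !in_itv/= => /andP[_ tx] /andP[xt _].
    by move: (le_lt_trans tx xt); rewrite ltxx.
split=> //.
have := @Rintegral_itvB R f (BLeft p) (BRight q) x i12.
rewrite !bnd_simp => /(_ px xq) /eqP; rewrite subr_eq => /eqP ->.
by rewrite Rintegral_itv_obnd_cbnd// addrC.
Qed.

Lemma C1_increment_le (h : R -> R) p q : p < q ->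
  (forall t, derivable h t 1) -> continuous (derive1 h) ->
  `|h q - h p| <= \int[mu]_(t in `[p, q]) `|derive1 h t|.
Proof.
move=> pq dh ch'.
have ch : continuous h by move=> t; exact/differentiable_continuous/derivable1_diffP.
have ih : mu.-integrable `[p, q] (EFin \o derive1 h).
  apply: continuous_compact_integrable; first exact: segment_compact.
  exact: continuous_subspaceT.
have -> : h q - h p = \int[mu]_(t in `[p, q]) derive1 h t.
  rewrite /Rintegral (@continuous_FTC2 _ _ h).
  - by [].
  - by [].
  - exact: continuous_subspaceT.
  - split; first by move=> t _; exact: dh.
    + exact: cvg_at_right_filter (ch p).
    + exact: cvg_at_left_filter (ch q).
  - by [].
exact: le_normr_Rintegral.
Qed.

Lemma derive1_eq_itv (c d : R -> plane) p q :
  {in `[p, q]%R, c =1 d} -> {in `]p, q[%R, derive1 c =1 derive1 d}.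
Proof.
move=> cd t tpq; rewrite !derive1E; apply: near_eq_derive.
have : \forall s \near t, s \in `]p, q[%R by exact: near_in_itvoo.
by apply: filterS => s spq; apply: cd; exact: subset_itv_oo_cc.
Qed.

Variables (L : plane -> R) (phi : {linear plane -> R^o}) (k : R).
Hypotheses (cL : continuous L) (cphi : continuous phi) (k_ge0 : 0 <= k).
Hypothesis phi_le : forall v, k * `|phi v| <= L v.

Let L_ge0 v : 0 <= L v.
Proof. by apply: le_trans (phi_le v); rewrite mulr_ge0. Qed.

(** Calibration: [L] is a speed and [phi] a linear form with [k * |phi| <= L]. Integrating along the
    curve bounds its length below by [k] times the variation of [phi], hence by [k] times its
    increment. *)
Lemma C1_length (c d : R -> plane) p q :
  p < q -> C1_curve d -> {in `[p, q]%R, c =1 d} ->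
  [/\ {within `[p, q], continuous c},
      mu.-integrable `[p, q] (EFin \o (L \o derive1 c)) &
      k * `|phi (c q - c p)| <= \int[mu]_(t in `[p, q]) L (derive1 c t)].
Proof.
move=> pq [dd cd'] cd.
have cd1 : continuous d by move=> t; exact/differentiable_continuous/derivable1_diffP.
have cLd : continuous (L \o derive1 d).
  by move=> t; apply: continuous_comp; [exact: cd'|exact: cL].
have cphid : continuous (phi \o derive1 d).
  by move=> t; apply: continuous_comp; [exact: cd'|exact: cphi].
have iLd : mu.-integrable `[p, q] (EFin \o (L \o derive1 d)).
  apply: continuous_compact_integrable; first exact: segment_compact.
  exact: continuous_subspaceT.
have cdE : {in `]p, q[%R, L \o derive1 c =1 L \o derive1 d}.
  by move=> t tpq /=; rewrite (derive1_eq_itv _ _ _ _ cd).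
have [iLc intE] := integrable_eq_itvoo _ _ _ _ cdE iLd.
have ends t : p <= t <= q -> c t = d t by move=> tpq; apply: cd; rewrite in_itv.
have cp : c p = d p by apply: ends; rewrite lexx ltW.
have cq : c q = d q by apply: ends; rewrite lexx ltW.
split; [|exact: iLc|].
  apply: (subspace_eq_continuous (f := d)); first by move=> t; rewrite inE => /cd.
  exact: continuous_subspaceT.
have -> : \int[mu]_(t in `[p, q]) L (derive1 c t) =
  \int[mu]_(t in `[p, q]) L (derive1 d t) by exact: intE.
rewrite cp cq {cdE intE iLc ends cp cq cd}.
pose h : R -> R := phi \o d.
have hE : derive1 h = phi \o derive1 d.
  by apply/funext => t; have [] := derivable_linear_comp phi d t cphi (dd t).
have dh t : derivable h t 1.
  by have [] := derivable_linear_comp phi d t cphi (dd t).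
have ch' : continuous (derive1 h) by rewrite hE.
apply: (@le_trans _ _ (k * \int[mu]_(t in `[p, q]) `|derive1 h t|)).
  apply: ler_wpM2l => //; rewrite linearB.
  exact: (C1_increment_le h).
have iabs : mu.-integrable `[p, q] (EFin \o (fun t => `|derive1 h t|)).
  apply: continuous_compact_integrable; first exact: segment_compact.
  apply: continuous_subspaceT => t; apply: continuous_comp; first exact: ch'.
  exact: norm_continuous.
rewrite -RintegralZl//; apply: le_Rintegral => //.
  apply: continuous_compact_integrable; first exact: segment_compact.
  apply: continuous_subspaceT => t; apply: cvgMr.
  apply: continuous_comp; first exact: ch'.
  exact: norm_continuous.
by move=> t _; rewrite hE; exact: phi_le.
Qed.

(** Induction on the partition: the increments of [phi] telescope and the triangle inequality adds
    up the bounds. Continuity of [c] comes along for the lifting of homotopies. *)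
Lemma piecewise_C1_length (c : R -> plane) s p q :
  p < q -> itv_partition p q s ->
  (forall i, (i < size s)%N -> exists2 d : R -> plane, C1_curve d &
     {in `[nth 0 (p :: s) i, nth 0 (p :: s) i.+1]%R, c =1 d}) ->
  [/\ {within `[p, q], continuous c},
      mu.-integrable `[p, q] (EFin \o (L \o derive1 c)) &
      k * `|phi (c q - c p)| <= \int[mu]_(t in `[p, q]) L (derive1 c t)].
Proof.
elim: s p => [p pq [_ /eqP pq']|x s IH p pq].
  by move: pq; rewrite /= in pq'; rewrite pq' ltxx.
move=> /= pP; have [/= /andP[px _] _] := pP.
move=> cs; have [d dC1 /= cd] := cs 0%N isT.
have [c1 i1 l1] := C1_length _ _ _ _ px dC1 cd.
have sP := itv_partition_cons pP.
have := itv_partition_le sP; rewrite le_eqVlt => /predU1P[<-//|xq].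
have [|c2 i2 l2] := IH x xq sP; first by move=> i si; exact: (cs i.+1).
have [i12 ->] := Rintegral_itv_cat _ _ _ _ (ltW px) (ltW xq) i1 i2.
split; [|exact: i12|].
- have -> : `[p, q] = `[p, x] `|` `[x, q].
    apply/seteqP; split=> t /=; rewrite !in_itv /=.
      by move=> /andP[pt tq]; case: (leP t x) => tx; [left|right]; rewrite ?pt// ltW.
    case=> /andP[t1 t2]; rewrite ?t1 ?t2 ?andbT.
      exact: le_trans t2 (ltW xq).
    by rewrite (le_trans (ltW px) t1).
  by apply: withinU_continuous => //; exact: itv_closed.
- apply: le_trans (lerD l1 l2); rewrite -mulrDr; apply: ler_wpM2l => //.
  have -> : c q - c p = (c x - c p) + (c q - c x) by rewrite [RHS]addrC addrA subrK.
  rewrite linearD; exact: ler_normD.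
Qed.

End Length.

(** * The family of flat metrics and its area *)

Lemma diff_affine (R : numFieldType) (V W : normedModType R) (L : {linear V -> W})
    (w : W) (z v : V) :
  continuous L -> 'd (fun x => L x + w) z v = L v.
Proof.
move=> cL; have dL : differentiable L z by exact: linear_differentiable.
have -> : (fun x => L x + w) = (L : V -> W) + cst w by [].
by rewrite diffD// diff_cst /= addr0 diff_lin.
Qed.

Section FlatMetric.
Local Open Scope classical_set_scope.
Context {R : realType}.
Variables (beta a : R).
Hypotheses (beta_gt0 : 0 < beta) (a_gt0 : 0 < a).
Local Notation plane := (R * R)%type.

Lemma smooth_cst (r : R) : smooth (fun=> r).
Proof.
move=> vs z.
have [r' ->] : exists r', foldr (fun v h => 'D_v h) (fun=> r) vs = (fun _ : plane => r').
  elim: vs => [|v vs [r' IH]]; first by exists r.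
  by exists 0 => /=; rewrite IH; apply/funext => w; exact: derive_cst.
exact: differentiable_cst.
Qed.

(** For [s = 1] or [s = -1], the linear part of a deck transformation. *)
Definition scale_snd (s : R) (v : plane) : plane := (v.1, s * v.2).

Lemma scale_snd_linear s : linear (scale_snd s).
Proof. by move=> r u v; rewrite /scale_snd; congr pair => /=; rewrite !mulrDr mulrCA. Qed.

HB.instance Definition _ s :=
  GRing.isLinear.Build R plane plane *:%R (scale_snd s) (scale_snd_linear s).

Lemma scale_snd_continuous s : continuous (scale_snd s).
Proof.
move=> v; apply: (@cvg_pair _ _ _ (nbhs v) (nbhs v.1) (nbhs (s * v.2))).
  exact: cvg_fst.
by apply: cvgMl_tmp; exact: cvg_snd.
Qed.

Lemma diff_deck f : deck beta f -> exists2 s : R, s * s = 1 &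
  forall z v, 'd f z v = (v.1, s * v.2).
Proof.
move=> /deck_normalP[m [k]]; have := sign_sqr m; rewrite /deck_normal.
move: ((-1) ^ m) => s s2 fE; exists s%:~R; first by rewrite -intrM s2.
move=> z v; have -> : f = fun w => scale_snd s%:~R w + (m%:~R * pi, k%:~R * (2 * beta)).
  by apply/funext => w; rewrite fE.
apply: (@diff_affine R plane plane (scale_snd s%:~R)).
exact: scale_snd_continuous.
Qed.

Definition flat_form (z v w : plane) : R :=
  a ^+ 2 * (v.1 * w.1) + a ^- 2 * (v.2 * w.2).

Lemma flat_form_linear (z u v w : plane) (r : R) :
  flat_form z (r *: u + v) w = r * flat_form z u w + flat_form z v w.
Proof. by rewrite /flat_form /= /GRing.scale /=; ring. Qed.

Lemma flat_form_sym (z v w : plane) : flat_form z v w = flat_form z w v.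
Proof. by rewrite /flat_form (mulrC v.1) (mulrC v.2). Qed.

Lemma flat_form_pos (z v : plane) : v != 0 -> 0 < flat_form z v v.
Proof.
case: v => x y; rewrite /flat_form -!expr2 /= => v0.
have a2 : 0 < a ^+ 2 by rewrite exprn_gt0.
have ai2 : 0 < a ^- 2 by rewrite invr_gt0.
have [x0|x0] := eqVneq x 0.
  have y0 : y != 0 by apply: contra v0 => /eqP ->; rewrite x0.
  by rewrite x0 expr0n mulr0 add0r mulr_gt0// exprn_even_gt0.
apply: ltr_pwDl; first by rewrite mulr_gt0// exprn_even_gt0.
by rewrite mulr_ge0 ?sqr_ge0// ltW.
Qed.

Lemma flat_form_smooth (v w : plane) : smooth (fun z => flat_form z v w).
Proof. exact: smooth_cst. Qed.

Lemma flat_form_invariant f : deck beta f -> forall z v w : plane,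
  flat_form (f z) ('d f z v) ('d f z w) = flat_form z v w.
Proof.
move=> /diff_deck[s s2 dE] z v w; rewrite !dE /flat_form /=.
by rewrite [s * _ * _]mulrACA s2 mul1r.
Qed.

Definition flat_metric : klein_metric beta :=
  KleinMetric flat_form_linear flat_form_sym flat_form_pos flat_form_smooth
    flat_form_invariant.

(** The Gram determinant is [a ^+ 2 * a ^- 2 = 1], so the area is that of the fundamental rectangle,
    whatever [a]. *)
Lemma vol_flat_metric : vol flat_metric = 2 * beta * pi.
Proof.
rewrite /vol; have -> : (fun z : plane => Num.sqrt (flat_metric z (1, 0) (1, 0) *
    flat_metric z (0, 1) (0, 1) - flat_metric z (1, 0) (0, 1) ^+ 2)) = fun=> 1.
  apply/funext => z; rewrite /= /flat_form /=.
  rewrite !(mulr0, mul0r, addr0, add0r, mulr1, expr0n, subr0) /=.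
  by rewrite divff ?sqrtr1// expf_neq0// gt_eqF.
rewrite Rintegral_cst ?mul1r; last by apply: measurableX.
pose X : set R := `[0, pi]; pose Y : set R := `[0, 2 * beta].
have XY : (@lebesgue_measure R \x @lebesgue_measure R)%E (X `*` Y) =
    (lebesgue_measure X * lebesgue_measure Y)%E.
  by rewrite product_measure1E//; exact: measurable_itv.
transitivity (fine (lebesgue_measure X * lebesgue_measure Y)%E); first by rewrite -XY.
rewrite !lebesgue_measure_itv /= !lte_fin pi_gt0.
by rewrite mulr_gt0// !sube0 -EFinM /= mulrC.
Qed.

(** [flat_form] does not depend on its base point; [0] stands for any of them. *)
Definition flat_speed (v : plane) : R := Num.sqrt (flat_form 0 v v).

Lemma flat_speed_continuous : continuous flat_speed.
Proof.
move=> v; apply: continuous_comp; last exact: sqrt_continuous.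
apply: cvgD; apply: cvgMl_tmp; apply: cvgM; do ?exact: cvg_fst.
  exact: cvg_snd.
exact: cvg_snd.
Qed.

(** Drop the nonnegative dy^2 term; [flat_speed_snd] drops the dx^2 term. These provide the
    calibrations by dx and dy. *)
Lemma flat_speed_fst v : a * `|v.1| <= flat_speed v.
Proof.
have -> : a * `|v.1| = Num.sqrt ((a * v.1) ^+ 2).
  by rewrite sqrtr_sqr normrM (gtr0_norm a_gt0).
apply: ler_wsqrtr; rewrite exprMn /flat_form -!expr2.
by rewrite lerDl mulr_ge0 ?sqr_ge0// invr_ge0 sqr_ge0.
Qed.

Lemma flat_speed_snd v : a^-1 * `|v.2| <= flat_speed v.
Proof.
have -> : a^-1 * `|v.2| = Num.sqrt ((a^-1 * v.2) ^+ 2).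
  by rewrite sqrtr_sqr normrM normfV (gtr0_norm a_gt0).
apply: ler_wsqrtr; rewrite exprMn /flat_form -!expr2.
by rewrite exprVn lerDr mulr_ge0 ?sqr_ge0.
Qed.

(* [inf] of the empty set is [0], so a competing curve has to be exhibited: the
   segment from the origin to its image by [f]. *)
Lemma least_length_ge (g : klein_metric beta) f m :
  (forall c : R -> plane, piecewise_C1 c ->
     klein_proj beta (c 0) = klein_proj beta (c 1) ->
     freely_homotopic (klein_proj beta \o c) (deck_loop beta f) ->
     m <= curve_length g c) ->
  deck beta f -> m <= least_length g f.
Proof.
move=> mc df; apply: lb_le_inf; last first.
  by move=> _ [c [cC1 c01 ch ->]]; exact: mc.
pose c (t : R) : plane := t *: f 0.
have clim (t : R) : h^-1 *: (c (h *: 1 + t) - c t) @[h --> 0^'] --> f 0.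
  apply: cvg_near_cst; near=> h; have h0 : h != 0 by near: h; exact: nbhs_dnbhs_neq.
  have -> : h *: 1 = h :> R by exact: mulr1.
  by rewrite /c -scalerBl addrK scalerA mulVf// scale1r.
exists (curve_length g c), c; split=> //.
- exists [:: 1]; first exact: itv_partition1.
  move=> [|//] _; exists c => //; split.
    by move=> t; apply/cvg_ex; exists (f 0); exact: clim.
  rewrite (_ : derive1 c = cst (f 0)); first exact: cst_continuous.
  by apply/funext => t; rewrite derive1E; exact: cvg_lim (clim t).
- by rewrite /c scale0r scale1r; apply/klein_proj_eq; exists f.
- exists (fun z => klein_proj beta (z.2 *: f 0)); split => //.
    apply: continuous_subspaceT => z; apply: continuous_comp; last exact: pi_continuous.
    by apply: cvgZl; exact: cvg_snd.
  move=> s _; rewrite scale0r scale1r /=; apply/klein_proj_eq; by exists f.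
Unshelve. all: by end_near. Qed.

(** * Displacements of conjugate deck transformations and the three length bounds *)

(** Horizontal shifts add up under composition, so conjugation by [h] does not change them. *)
Lemma displacement_fst (f g h : plane -> plane) z : deck beta g -> deck beta h ->
  g (h 0) = h (f 0) -> (g z).1 - z.1 = (f 0).1.
Proof.
move=> /deck_normalP[m [k gE]] /deck_normalP[m' [k' hE]].
rewrite !gE !hE => /(congr1 fst) /=; lra.
Qed.

(** The horizontal shift of [g] vanishes, so [g] contains no reflection and is a vertical
    translation. Its direction is reversed when [h] reflects, hence the absolute value. *)
Lemma displacement_vtrans (g h : plane -> plane) z : deck beta g -> deck beta h ->
  g (h 0) = h (vtrans beta 0) -> `|(g z).2 - z.2| = 2 * beta.
Proof.
move=> dg dh gh; have := displacement_fst _ _ _ z dg dh gh.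
move: dg dh gh => /deck_normalP[m [k gE]] /deck_normalP[m' [k' hE]].
rewrite !gE !hE /= => -[_ gh2] /eqP.
rewrite addrC addKr mulf_eq0 (gt_eqF (pi_gt0 R)) orbF intr_eq0 => /eqP m0.
move: gh2; rewrite m0 expr0z !mul1r mulr0 !add0r [X in _ = X]addrC => /addrI ->.
by rewrite addrC addKr normrM norm_sign mul1r ger0_norm// mulr_ge0// ltW.
Qed.

(** Both calibrations are applied to the same lift [c], whose end point is [g (c 0)]. *)
Let length_bounds f c : deck beta f -> piecewise_C1 c ->
  klein_proj beta (c 0) = klein_proj beta (c 1) ->
  freely_homotopic (klein_proj beta \o c) (deck_loop beta f) ->
  exists g h, [/\ deck beta g, deck beta h, g (h 0) = h (f 0),
    a * `|(g (c 0)).1 - (c 0).1| <= curve_length flat_metric c &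
    a^-1 * `|(g (c 0)).2 - (c 0).2| <= curve_length flat_metric c].
Proof.
move=> df [s sP cs] c01 ch.
have [cc _ l1] := piecewise_C1_length flat_speed (@fst R^o R^o) a
  flat_speed_continuous (fun=> cvg_fst) (ltW a_gt0) flat_speed_fst _ _ _ _
  ltr01 sP cs.
have ai0 : 0 <= a^-1 by rewrite invr_ge0 ltW.
have [_ _ l2] := piecewise_C1_length flat_speed (@snd R^o R^o) a^-1
  flat_speed_continuous (fun=> cvg_snd) ai0 flat_speed_snd _ _ _ _
  ltr01 sP cs.
have [g [h [dg dh gh cg]]] := free_homotopy_conjugate _ beta_gt0 _ _ df cc c01 ch.
by exists g, h; split=> //; rewrite -cg.
Qed.

Lemma least_length_flat_fst f : deck beta f ->
  a * `|(f 0).1| <= least_length flat_metric f.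
Proof.
move=> df; apply: least_length_ge => // c cC1 c01 ch.
have [g [h [dg dh gh l1 _]]] := length_bounds f c df cC1 c01 ch.
by rewrite -(displacement_fst _ _ _ (c 0) dg dh gh).
Qed.

Lemma l_v_flat : a^-1 * (2 * beta) <= l_v flat_metric.
Proof.
apply: least_length_ge; last exact: deck_vtrans.
move=> c cC1 c01 ch.
have [g [h [dg dh gh _ l2]]] := length_bounds _ c (deck_vtrans beta) cC1 c01 ch.
by rewrite -(displacement_vtrans _ _ (c 0) dg dh gh).
Qed.

Lemma l_sigma_flat : a * pi <= l_sigma flat_metric.
Proof.
have := least_length_flat_fst _ (deck_glide beta).
by rewrite /= add0r ger0_norm// pi_ge0.
Qed.

Lemma l_h_flat : a * (pi + pi) <= l_h flat_metric.
Proof.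
have := least_length_flat_fst _ (deck_comp (deck_glide beta) (deck_glide beta)).
by rewrite /= add0r ger0_norm// addr_ge0// pi_ge0.
Qed.

End FlatMetric.

(** * Unboundedness of the product of the lengths at fixed area *)

Theorem corollary1p6 (R : realType) (beta : R) (beta_gt0 : 0 < beta) :
  ~ exists c : R, forall g : klein_metric beta,
      l_v g * l_sigma g * l_h g <= c * vol g `^ (3 / 2).
Proof.
move=> [c cle].
(* The right-hand side is this same number for all flat metrics of the family. *)
pose C := c * (2 * beta * pi) `^ (3 / 2).
have pi0 := pi_gt0 R.
(* The product of the three lower bounds is [a * K]. *)
pose K := 2 * beta * pi * (pi + pi).
have K0 : 0 < K by rewrite !mulr_gt0// addr_gt0.
(* With this choice [a * K = |C| + K], which exceeds [C]. *)
pose a := `|C| / K + 1.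
have a0 : 0 < a by rewrite ltr_wpDl// divr_ge0// ltW.
have := cle (flat_metric beta a a0); rewrite vol_flat_metric// -/C.
apply/negP; rewrite -ltNge.
apply: (@lt_le_trans _ _ (a^-1 * (2 * beta) * (a * pi) * (a * (pi + pi)))).
  have -> : a^-1 * (2 * beta) * (a * pi) * (a * (pi + pi)) = a * K.
    by rewrite /K; field; rewrite gt_eqF.
  rewrite /a mulrDl mul1r divfK ?gt_eqF//.
  by rewrite (le_lt_trans (ler_norm C))// ltrDl.
have ai0 : 0 < a^-1 by rewrite invr_gt0.
have nn : 0 <= 2 * beta by rewrite mulr_ge0// ltW.
have v0 : 0 <= a^-1 * (2 * beta) by rewrite mulr_ge0// ltW.
have s0 : 0 <= a * pi by rewrite mulr_ge0// ltW.
have h0 : 0 <= a * (pi + pi) by rewrite mulr_ge0// ltW// addr_gt0.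
have lv := l_v_flat beta a beta_gt0 a0.
have ls := l_sigma_flat beta a beta_gt0 a0.
have lh := l_h_flat beta a beta_gt0 a0.
exact: ler_pM (mulr_ge0 v0 s0) h0 (ler_pM v0 s0 lv ls) lh.
Qed.
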